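(* Let $G$ be a connected threshold graph with vertices $[n]$ and degree sequence $\lambda$. Then $$ \sum_{T \in \mathrm{Tree}(G)} \ \prod_{i=1}^n x_i^{\mathrm{indeg}_T(i)}\, y_i^{\mathrm{outdeg}_T(i)} = x_1 y_n \prod_{r=2}^{n-1} \left( \sum_{i=1}^{\lambda_r'} x_{\min\{i,r\}}\, y_{\max\{i,r\}} \right). $$ In particular, setting $y_i=x_i$ gives $$ \sum_{T \in \mathrm{Tree}(G)} x^{\deg(T)} = x_1 x_2 \cdots x_n \prod_{r=2}^{n-1} \left( \sum_{i=1}^{\lambda_r'} x_i \right). $$
   Context: Notation: $[n]=\{1,2,\ldots,n\}$, and $x_1,\ldots,x_n,y_1,\ldots,y_n$ are indeterminates. A (finite simple) graph $G$ is threshold if, after labelling its vertices by $[n]$ in weakly decreasing order of their degrees, the degree sequence $\lambda=(\lambda_1\geq\cdots\geq\lambda_n)$ ($\lambda_i$ being the degree of vertex $i$) determines the graph completely by the rule that the neighbors of vertex $i$ are the $\lambda_i$ smallest members of $[n]$ other than $i$ itself. The statement that $G$ is a threshold graph with vertices $[n]$ and degree sequence $\lambda$ means that the vertices carry such a labelling. The conjugate partition $\lambda'$ is given by $\lambda'_r = |\{i\in[n] : \lambda_i\geq r\}|$ (its Ferrers diagram is obtained from that of $\lambda$ by flipping across the diagonal). $\mathrm{Tree}(G)$ is the set of all spanning trees of $G$. In any spanning tree $T$ of $G$, each edge $\{i,j\}$ with $j>i$ is oriented from $j$ to $i$; $\mathrm{indeg}_T(i)$ and $\mathrm{outdeg}_T(i)$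 denote the number of edges of $T$ oriented into, respectively out of, the vertex $i$. Finally $x^{\deg(T)}:=\prod_{i=1}^n x_i^{\deg_T(i)}$, where $\deg_T(i)$ is the degree of vertex $i$ in $T$.
   Formalization: The formal theorem assumes n ≥ 2; for n = 1 the one-vertex graph is connected and threshold, but the left sides equal 1 while the right sides are x_1 y_1 and x_1, so the identities fail there. *)

(* Defs.v *)
From HB Require Import structures.
From mathcomp Require Import all_boot all_order all_algebra.
From mathcomp Require Import mpoly.

Set Implicit Arguments.
Unset Strict Implicit.
Unset Printing Implicit Defensive.

Import Order.TTheory GRing.Theory.
Local Open Scope ring_scope.

(* A graph on the vertex set V is given by its set of edges, an edge being an
   unordered pair of vertices; a spanning subgraph is then a subset of edges. *)
Section Graphs.
Variable V : finType.
Implicit Types (E T : {set {set V}}) (i j : V).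

Definition simple_graph E := [forall A in E, #|A| == 2].

Definition adj E : rel V := fun i j => (i != j) && ([set i; j] \in E).

Definition deg E i : nat := #|[set j | adj E i j]|.

Definition connected E := [forall i, forall j, connect (adj E) i j].

(* A cycle has at least 3 vertices, all distinct, so that bounding its length
   by #|V| loses nothing: see acyclicP. *)
Definition acyclic E :=
  [forall k : 'I_#|V|.+1, (2 < k)%N ==>
    [forall c : k.-tuple V, ~~ ucycleb (adj E) c]].

Lemma acyclicP E :
  reflect (forall c : seq V, (2 < size c)%N -> ~ ucycle (adj E) c) (acyclic E).
Proof.
apply: (iffP forallP) => [acE c c_gt2 /andP[cyc uc] | acE k].
  have c_lt : (size c < #|V|.+1)%N by rewrite ltnS -(card_uniqP uc) max_card.
  have /implyP/(_ c_gt2)/forallP/(_ (in_tuple c)) := acE (Ordinal c_lt).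
  by rewrite /ucycleb cyc uc.
apply/implyP => k_gt2; apply/forallP => c; apply/negP.
by apply: acE; rewrite size_tuple.
Qed.

Definition spanning_tree E T := [&& T \subset E, connected T & acyclic T].

End Graphs.

(* The vertex labelled i in {1, ..., n} is the ordinal i - 1 of 'I_n. *)
Section Labelled.
Variable n : nat.
Implicit Types (E T : {set {set 'I_n}}) (i j : 'I_n) (lambda : 'I_n -> nat).

(* enum 'I_n is increasing *)
Definition smallest_others (k : nat) i : seq 'I_n :=
  take k [seq j <- enum 'I_n | j != i].

Definition threshold E lambda :=
  [/\ forall i, lambda i = deg E i,
      forall i j, (i <= j)%N -> (lambda j <= lambda i)%N
    & forall i j, adj E i j = (j \in smallest_others (lambda i) i)].

Definition conj_part lambda (r : nat) : nat := #|[set i | (r <= lambda i)%N]|.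

(* the edge {i, j} of T is oriented from i to j *)
Definition arc T : rel 'I_n := fun i j => (j < i)%N && adj T i j.

Definition indeg T i : nat := #|[set j | arc T j i]|.
Definition outdeg T i : nat := #|[set j | arc T i j]|.

(* the 2n indeterminates x_1, ..., x_n, y_1, ..., y_n *)
Definition xvar (R : comNzRingType) i : {mpoly R[n + n]} := 'X_(lshift n i).
Definition yvar (R : comNzRingType) i : {mpoly R[n + n]} := 'X_(rshift n i).

End Labelled.

(* Main.v *)
Require Import Defs.
From HB Require Import structures.
From mathcomp Require Import all_boot all_order all_algebra.
From mathcomp Require Import all_fingroup.
From mathcomp Require Import mpoly.
From mathcomp Require Import zify.

Set Implicit Arguments.
Unset Strict Implicit.
Unset Printing Implicit Defensive.

Import Order.TTheory GRing.Theory.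
Local Open Scope ring_scope.

(** The enumerator of spanning trees, with edge {i, j} weighted by
    x_min(i,j) y_max(i,j), is a reduced weighted Laplacian determinant
    ([tree_enumerator_det]), and for a threshold graph suitable row
    operations make that Laplacian triangular ([det_threshold_laplacian]).

    For the first point, root all the trees at one vertex: orienting its
    edges towards the root turns a spanning tree into a function f sending
    each vertex to its parent, the root being a fixed point that all
    iterations reach. This is a bijection ([sum_spanning_trees]). On the
    determinant side, the row of a vertex r <> root is the sum over its
    neighbours i of w(r, i) (e_r - e_i); expanding all rows gives a sum over
    all functions f of a product of weights times the determinant of the
    matrix with rows e_r - e_(f r), which is 1 if f is a parent function and
    0 otherwise ([det_parent_mx]): following f strictly decreases the
    distance to the root in the first case, and the indicator function of
    the vertices that never reach the root lies in the kernel in the second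
    case.

    For the second point, with vertices numbered from 0, let s be the least
    vertex with lambda s <= s. Then lambda s = s, the vertices r < s form a
    clique, the vertices r >= s are pairwise non-adjacent, and r >= s is
    adjacent exactly to the lambda r first vertices, so that the only
    off-diagonal entries of its Laplacian row are -y_r x_j for j < lambda r.
    Take s as the root. The columns of the full Laplacian sum to zero, so
    adding all rows to row 0 produces the opposite of the missing row of s,
    that is y_s v with v_j = x_j for j < s and v_j = 0 otherwise, once the
    entry in column s is cleared by means of the unit row that replaces the
    row of s. Take out y_s and add y_r v to every other row r <> s. In a row
    r < s this cancels the entries j < r; in a row r > s it cancels the
    entries j < lambda r. What remains is triangular once each r >= s is
    moved to just after the clique vertex lambda r - 1. The diagonal
    consists of x_0, of 1 at s, of the sums y_r (x_0 + ... + x_r) + x_r (sum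
    of y_i over the neighbours i > r) for 0 < r < s, which are the factors
    at r, and of the y_r (sum of x_i over i < lambda r) for r > s. Up to y_s
    and the last y, the latter are the factors at s, s + 1, ... after a
    shift by one, since for r >= s the condition r < lambda i means that i
    is adjacent to r + 1.

    All of this holds over an arbitrary commutative ring, so the second
    identity is the first one at y = x. *)

(** * Determinants of matrices that are triangular in some order *)

(** A permutation s contributing to the determinant satisfies rank i <= rank
    (s i), strictly where s moves i; as both sides have the same sum over i,
    s is the identity. Equal ranks are allowed for distinct indices provided
    that the corresponding entries vanish. *)
Lemma det_ranked (A : comPzRingType) n (M : 'M[A]_n) (rank : 'I_n -> nat) :
  (forall i j, i != j -> M i j != 0 -> (rank i < rank j)%N) ->
  \det M = \prod_i M i i.
Proof.
move=> rankM; rewrite /determinant (bigD1 (1%g : 'S_n)) //=.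
rewrite odd_perm1 expr0 mul1r [X in _ + X]big1 => [|s s_neq1].
  by rewrite addr0; apply: eq_bigr => i _; rewrite perm1.
have [i /eqP Mi0|M_neq0] := pickP (fun i => M i (s i) == 0).
  by rewrite (bigD1 i) //= Mi0 mul0r mulr0.
have le_rank i : true -> (rank i <= rank (s i) ?= iff (i == s i))%N.
  move=> _; have [<-|neq_i] := eqVneq i (s i); first by split; rewrite ?eqxx.
  have lt_i := rankM _ _ neq_i (negbT (M_neq0 i)).
  by split; [apply: ltnW | rewrite ltn_eqF].
have [_] := leqif_sum le_rank.
rewrite [X in X == _](reindex_inj (@perm_inj _ s)) /= eqxx.
move=> /esym/forallP fix_s; case/eqP: s_neq1; apply/permP => i.
by rewrite perm1; apply/esym/eqP/fix_s.
Qed.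

(** * Parent functions and the matrix-tree theorem *)

Section ParentFunctions.
Variables (V : finType) (root : V).
Implicit Types (f g : {ffun V -> V}).

(** These are the trees on V oriented towards the root. The value at the
    root is fixed so that each tree is represented once. *)
Definition parent_fun f := (f root == root) && [forall r, fconnect f r root].

Definition depth f r := findex f r root.

Lemma depth_parent f r :
  parent_fun f -> r != root -> depth f r = (depth f (f r)).+1.
Proof.
move=> /andP[_ /forallP reach] r_root.
by rewrite /depth fconnect_findex // eq_sym.
Qed.

Lemma parent_fun_neq f r : parent_fun f -> r != root -> f r != r.
Proof.
move=> fP r_root; apply/eqP => fr; have := depth_parent fP r_root.
by rewrite fr => /n_Sn.
Qed.

Lemma parent_fun_root f : parent_fun f -> f root = root.
Proof. by case/andP=> /eqP. Qed.

Lemma parent_fun_neq2 f r : parent_fun f -> r != root -> f (f r) != r.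
Proof.
move=> fP r_root; apply/eqP => ffr.
have [fr_root|fr_root] := eqVneq (f r) root.
  by move: ffr r_root; rewrite fr_root parent_fun_root // => <-; rewrite eqxx.
have := depth_parent fP r_root; rewrite (depth_parent fP fr_root) ffr => E.
by have := leqnSn (depth f r).+1; rewrite -E ltnn.
Qed.

End ParentFunctions.

Section MatrixTree.
Variables (A : comNzRingType) (n : nat) (root : 'I_n).
Implicit Types (f : {ffun 'I_n -> 'I_n}) (w : 'I_n -> 'I_n -> A).

Definition parent_mx f : 'M[A]_n :=
  \matrix_(r, j) ((r == j)%:R - ((r != root) && (f r == j))%:R).

(** If f is a parent function, depth makes the matrix triangular with ones
    on the diagonal; otherwise the indicator vector of the vertices that
    never reach the root is a kernel vector with an entry 1. *)
Lemma det_parent_mx f :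
  f root = root -> \det (parent_mx f) = (parent_fun root f)%:R.
Proof.
move=> f_root; have [fP|] := boolP (parent_fun root f).
  (* The only entry of row r off the diagonal is in the column of its parent,
     which is less deep; depth is subtracted from n to make ranks increase. *)
  rewrite (det_ranked (rank := fun r => n - depth root f r)%N) => [|r j r_j].
    rewrite big1 // => r _; rewrite mxE eqxx.
    have [//|r_root] := eqVneq r root; first by rewrite subr0.
    by rewrite (negbTE (parent_fun_neq fP r_root)) subr0.
  rewrite mxE (negbTE r_j) sub0r oppr_eq0.
  have [_|r_root] := eqVneq r root; first by rewrite eqxx.
  have [<-|_] := eqVneq (f r) j; last by rewrite eqxx.
  have := findex_max (forallP (andP fP).2 r).
  rewrite -[findex _ _ _]/(depth root f r) (depth_parent fP r_root) => lt_r _.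
  have le_n: (fingraph.order f r <= n)%N by rewrite -[leqRHS]card_ord max_card.
  by apply: ltn_sub2l => //; apply: leq_trans le_n; apply: ltnW.
rewrite /parent_fun f_root eqxx /= negb_forall => /existsP[c not_reach].
pose u : 'cV[A]_n := \col_r (~~ fconnect f r root)%:R.
(* u is in the kernel: r reaches the root if and only if f r does *)
have Mu0 : parent_mx f *m u = 0.
  apply/matrixP => r j; rewrite !mxE.
  under eq_bigr => i _ do rewrite !mxE mulrBl.
  rewrite sumrB (bigD1 r) //= eqxx mul1r big1 ?addr0 => [|i i_r]; last first.
    by rewrite eq_sym (negbTE i_r) mul0r.
  have [->|r_root] /= := eqVneq r root.
    by rewrite connect0 big1 ?subr0 // => i _; rewrite mul0r.
  rewrite (bigD1 (f r)) //= eqxx mul1r big1 ?addr0 => [|i i_r]; last first.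
    by rewrite eq_sym (negbTE i_r) mul0r.
  by rewrite [in X in X - _]fconnect_eqVf (negbTE r_root) subrr.
have /matrixP/(_ c ord0) : \adj (parent_mx f) *m (parent_mx f *m u) = 0.
  by rewrite Mu0 mulmx0.
by rewrite mulmxA mul_adj_mx mul_scalar_mx !mxE not_reach mulr1 => ->.
Qed.

(** The row of the root is replaced by a unit vector rather than deleted
    together with its column, which keeps the index type unchanged and gives
    the same determinant. *)
Definition rooted_laplacian w : 'M[A]_n :=
  \matrix_(r, j) (if r == root then (j == root)%:R
                  else (r == j)%:R * (\sum_i w r i) - w r j).

(** Matrix-tree theorem for an arbitrary weighted digraph: the determinant
    is multilinear in its rows, and row r is the combination of the
    differences e_r - e_i with coefficients w r i. *)
Lemma matrix_tree w :
  \det (rooted_laplacian w) =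
  \sum_(f : {ffun 'I_n -> 'I_n} | parent_fun root f)
    \prod_(r | r != root) w r (f r).
Proof.
(* with these weights the row of the root has the same form as the others,
   and only functions fixing the root have a non-zero product of weights *)
pose w' r i := if r == root then (i == root)%:R else w r i.
have lapE r j : rooted_laplacian w r j =
    \sum_i w' r i * ((r == j)%:R - ((r != root) && (i == j))%:R).
  rewrite mxE /w'; have [->|r_root] /= := eqVneq r root.
    rewrite (bigD1 root) //= eqxx mul1r subr0 [j == _]eq_sym big1 ?addr0 //.
    by move=> i /negbTE->; rewrite mul0r.
  under [RHS]eq_bigr => i _ do rewrite mulrBr.
  rewrite sumrB -big_distrl /= mulrC; congr (_ - _).
  rewrite (bigD1 j) //= eqxx mulr1 big1 ?addr0 // => i /negbTE->.
  by rewrite mulr0.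
transitivity (\sum_(f : {ffun 'I_n -> 'I_n})
                (\prod_r w' r (f r)) * \det (parent_mx f)).
  rewrite /determinant; under eq_bigr => s _.
    under eq_bigr => r _ do rewrite lapE.
    rewrite bigA_distr_bigA /= big_distrr /=; over.
  rewrite exchange_big /=; apply: eq_bigr => f _; rewrite big_distrr /=.
  apply: eq_bigr => s _; rewrite big_split /= mulrCA; congr (_ * (_ * _)).
  by apply: eq_bigr => r _; rewrite mxE.
rewrite [RHS]big_mkcond; apply: eq_bigr => f _.
rewrite (bigD1 root) //= {1}/w' eqxx.
have [f_root|f_root] := eqVneq (f root) root; last first.
  by rewrite /parent_fun (negbTE f_root) !mul0r.
rewrite det_parent_mx // mul1r; case: ifP => _; rewrite ?mulr0 // mulr1.
by apply: eq_bigr => r /negbTE r_root; rewrite /w' r_root.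
Qed.

End MatrixTree.

(** * Spanning trees as parent functions *)

Section TreesAsParentFunctions.
Variables (V : finType) (root : V).
Implicit Types (f g : {ffun V -> V}) (G T : {set {set V}}).

Definition tree_of f := [set [set r; f r] | r in [set~ root]].

Lemma set2_eq (a b c d : V) :
  a != b -> [set a; b] = [set c; d] -> (a = c /\ b = d) \/ (a = d /\ b = c).
Proof.
move=> ab E; have : a \in [set c; d] by rewrite -E set21.
have : b \in [set c; d] by rewrite -E set22.
rewrite !inE => /orP[]/eqP bE /orP[]/eqP aE; auto.
  by rewrite aE bE eqxx in ab.
by rewrite aE bE eqxx in ab.
Qed.

Lemma adj_sym T i j : adj T i j = adj T j i.
Proof. by rewrite /adj eq_sym setUC. Qed.

Lemma adj_tree_of f i j : parent_fun root f ->
  adj (tree_of f) i j =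
  ((i != root) && (f i == j)) || ((j != root) && (f j == i)).
Proof.
move=> fP; apply/andP/orP => [[ij /imsetP[r]]|[]/andP[r_root /eqP<-]].
- rewrite !inE => r_root /(set2_eq ij)[] [-> ->]; rewrite r_root eqxx; auto.
- split; first by rewrite eq_sym (parent_fun_neq fP).
  by apply/imsetP; exists i; rewrite ?inE.
split; first exact: (parent_fun_neq fP).
by rewrite setUC; apply/imsetP; exists j; rewrite ?inE.
Qed.

Lemma adj_parent f r : parent_fun root f -> r != root -> adj (tree_of f) r (f r).
Proof. by move=> fP r_root; rewrite adj_tree_of // r_root eqxx. Qed.

Lemma connected_tree_of f : parent_fun root f -> connected (tree_of f).
Proof.
move=> fP; have to_root i : connect (adj (tree_of f)) i root.
  have [d] := ubnP (depth root f i); elim: d i => // d IH i.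
  have [-> _|i_root] := eqVneq i root; first exact: connect0.
  rewrite (depth_parent fP i_root) ltnS => /IH; apply: connect_trans.
  exact/connect1/adj_parent.
apply/forallP => i; apply/forallP => j; apply: connect_trans (to_root i) _.
by rewrite (sym_connect_sym (adj_sym _)).
Qed.

(** The deepest vertex of a cycle would have its two distinct neighbours on
    the cycle both equal to its parent. *)
Lemma acyclic_tree_of f : parent_fun root f -> acyclic (tree_of f).
Proof.
move=> fP; apply/acyclicP => c c_gt2 /andP[cyc_c uniq_c].
have [c0 c0_in] : {c0 | c0 \in c}.
  by case: c c_gt2 {cyc_c uniq_c} => // c0 c _; exists c0; rewrite mem_head.
case: (@arg_maxnP V c0 (mem c) (depth root f)) => //= m m_in deepest.
have parent_only i : i \in c -> adj (tree_of f) m i -> i = f m.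
  move=> i_in; rewrite adj_tree_of // => /orP[/andP[_ /eqP->] //|].
  case/andP=> i_root /eqP fi_m; have := deepest i i_in.
  by rewrite (depth_parent fP i_root) fi_m ltnn.
have [i p rot_c] := rot_to m_in.
have size_p : (1 < size p)%N.
  by rewrite -ltnS -[(size p).+1]/(size (m :: p)) -rot_c size_rot.
have := cyc_c; rewrite -(rot_cycle i) rot_c /= rcons_path => /andP[path_p last_m].
have mem_p j : j \in p -> j \in c.
  by move=> j_in; rewrite -(mem_rot i) rot_c inE j_in orbT.
have : uniq p by move: uniq_c; rewrite -(rot_uniq i) rot_c => /andP[].
case: p size_p path_p last_m mem_p {rot_c} => [|a [|b p]] //= _.
case/andP=> m_a _ last_m mem_p /andP[/negP a_notin _]; apply: a_notin.
rewrite (parent_only a) ?mem_p ?mem_head //.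
rewrite -(parent_only (last b p)) ?mem_last //.
  by rewrite mem_p // inE mem_last orbT.
by rewrite adj_sym.
Qed.

(** If f and g give the same tree but differ at r, then the edge from r to f
    r must come from g (f r) = r, so f and g differ at f r as well; climbing
    along f this persists, but at the root f and g agree. *)
Lemma tree_of_inj : {in parent_fun root &, injective tree_of}.
Proof.
move=> f g fP gP fg; apply/ffunP => r.
have [->|r_root] := eqVneq r root; first by rewrite !parent_fun_root.
apply/eqP/negPn/negP => fr_gr.
have climb i : i != root -> f i != g i -> g (f i) = i /\ f i != root.
  move=> i_root fi_gi; have := adj_parent fP i_root.
  rewrite fg adj_tree_of // [g i == _]eq_sym (negbTE fi_gi) andbF /=.
  by case/andP=> fi_root /eqP.
have [d] := ubnP (depth root f r); elim: d r r_root fr_gr => // d IH r r_root.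
move=> fr_gr; have [gfr fr_root] := climb r r_root fr_gr.
rewrite (depth_parent fP r_root) ltnS; apply: IH => //.
by rewrite gfr (parent_fun_neq2 fP).
Qed.

Lemma spanning_tree_of G f : parent_fun root f ->
  spanning_tree G (tree_of f) = [forall (r | r != root), adj G r (f r)].
Proof.
move=> fP; rewrite /spanning_tree connected_tree_of ?acyclic_tree_of // !andbT.
apply/subsetP/forall_inP => [sub r r_root|edge _ /imsetP[r + ->]].
  rewrite /adj eq_sym (parent_fun_neq fP) //=; apply: sub.
  by apply/imsetP; exists r; rewrite ?inE.
by rewrite !inE => /edge/andP[].
Qed.

(** Let f r be a neighbour of r in T at smaller distance from the root. The
    tree of f is contained in T, and it is all of T: an edge {a, b} of T
    outside it would close a cycle with the path from a to b inside it. *)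
Lemma spanning_tree_parent G T : simple_graph G -> spanning_tree G T ->
  exists2 f, parent_fun root f & tree_of f = T.
Proof.
move=> /forall_inP simpleG /and3P[subG /forallP conn /acyclicP acyc].
pose near r k := [exists p : k.-tuple V, path (adj T) r p && (last r p == root)].
have nearP r : exists k, near r k.
  have /connectP[p path_p last_p] := forallP (conn r) root.
  exists (size p); apply/existsP; exists (in_tuple p).
  by rewrite path_p -last_p /=.
pose dist r := ex_minn (nearP r).
have closer r : r != root -> exists j, adj T r j && (dist j < dist r)%N.
  move=> r_root; rewrite /dist.
  case: (ex_minnP (nearP r)) => -[|k] /existsP[p].
    by rewrite tuple0 /= (negbTE r_root).
  case/tupleP: p => j p /=; rewrite -andbA => /and3P[rj path_p last_p] _.
  exists j; rewrite rj /=; case: ex_minnP => m _; apply.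
  by apply/existsP; exists p; rewrite path_p.
pose f := [ffun r => odflt root
  [pick j | [&& r != root, adj T r j & (dist j < dist r)%N]]].
have f_edge r : r != root -> adj T r (f r) /\ (dist (f r) < dist r)%N.
  move=> r_root; rewrite ffunE; case: pickP => [j /and3P[]//|none].
  by have [j] := closer r r_root; move/(_ j): none; rewrite r_root => /= ->.
have fP : parent_fun root f.
  rewrite /parent_fun ffunE; case: pickP => [?|_]; first by rewrite eqxx.
  rewrite eqxx /=; apply/forallP => r; have [d] := ubnP (dist r).
  elim: d r => // d IH r; have [-> _|r_root] := eqVneq r root.
    exact: connect0.
  rewrite ltnS => lt_d; apply: connect_trans (fconnect1 _ _) _; apply: IH.
  exact: leq_trans (f_edge r r_root).2 lt_d.
exists f => //; have sub_fT : tree_of f \subset T.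
  apply/subsetP => _ /imsetP[r + ->]; rewrite !inE => /f_edge[].
  by case/andP.
apply/eqP; rewrite eqEsubset sub_fT /=; apply/subsetP => e eT.
have /cards2P[a [b [ab e_ab]]] := simpleG e (subsetP subG e eT).
rewrite {}e_ab {e} in eT *; apply/negPn/negP => ab_notin.
have /connectP[p0 path_p0 last_p0] :=
  forallP (forallP (connected_tree_of fP) a) b.
case/shortenP: path_p0 last_p0 => p path_p uniq_p _ last_p {p0}.
have size_p : (1 < size p)%N.
  case: p path_p last_p {uniq_p} => [_ ba|c [|//]] /=.
    by rewrite ba eqxx in ab.
  by rewrite andbT => /andP[_ ac] bc; rewrite bc ac in ab_notin.
case: (acyc (a :: p)) => //; rewrite /ucycle uniq_p andbT /= rcons_path -last_p.
rewrite adj_sym {2}/adj ab eT !andbT; apply: sub_path path_p => i j.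
by case/andP=> ij /(subsetP sub_fT); rewrite /adj ij.
Qed.

Lemma sum_spanning_trees (A : nmodType) G (F : {set {set V}} -> A) :
  simple_graph G ->
  \sum_(T | spanning_tree G T) F T =
  \sum_(f | parent_fun root f && [forall (r | r != root), adj G r (f r)])
    F (tree_of f).
Proof.
move=> simpleG.
pose P f := parent_fun root f && [forall (r | r != root), adj G r (f r)].
rewrite (eq_bigl (mem (tree_of @: [set f | P f]))) => [|T]; last first.
  apply/esym; apply/imsetP/idP => [[f + ->]|T_tree].
    by rewrite inE => /andP[fP]; rewrite spanning_tree_of.
  have [f fP fT] := spanning_tree_parent simpleG T_tree.
  by exists f; rewrite // inE /P fP -spanning_tree_of // fT.
rewrite big_imset; first by apply: eq_bigl => f; rewrite inE.
by move=> f g; rewrite !inE => /andP[fP _] /andP[gP _]; apply: tree_of_inj.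
Qed.

End TreesAsParentFunctions.

(** * The tree enumerator as a determinant *)

Section TreeWeights.
Variables (A : comNzRingType) (n : nat) (x y : 'I_n -> A).
Implicit Types (f : {ffun 'I_n -> 'I_n}) (T : {set {set 'I_n}}).

Lemma prod_degrees_arcs T :
  \prod_i (x i ^+ indeg T i * y i ^+ outdeg T i) =
  \prod_(p | Defs.arc T p.1 p.2) (y p.1 * x p.2).
Proof.
rewrite [RHS]big_split -(pair_big_dep predT (Defs.arc T) (fun i _ => y i)) /=.
rewrite -(pair_big_dep predT (Defs.arc T) (fun _ j => x j)) /=.
rewrite [X in _ * X](exchange_big_dep predT) //= mulrC -big_split /=.
by apply: eq_bigr => i _; rewrite !prodr_const /indeg /outdeg !cardsE.
Qed.

(** Each arc (larger endpoint, smaller endpoint) of the tree joins exactly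
    one vertex to its parent. *)
Lemma prod_arcs_tree_of (root : 'I_n) f (F : 'I_n * 'I_n -> A) :
  parent_fun root f ->
  \prod_(p | Defs.arc (tree_of root f) p.1 p.2) F p =
  \prod_(r | r != root) F (Order.max r (f r), Order.min r (f r)).
Proof.
move=> fP; pose h r := (Order.max r (f r), Order.min r (f r)).
have hE r : h r = if (r < f r)%N then (f r, r) else (r, f r).
  by rewrite /h /Order.max /Order.min ltEord; case: ifP.
rewrite (eq_bigl (mem (h @: [set~ root]))) => [|[i j] /=]; last first.
  rewrite /Defs.arc adj_tree_of //=; apply/esym; apply/imsetP/andP => [[r]|[ji]].
    rewrite !inE hE => r_root; case: ltnP => [r_f|f_r] [-> ->].
      by rewrite r_f r_root eqxx orbT.
    by rewrite r_root eqxx ltn_neqAle f_r andbT val_eqE (parent_fun_neq fP).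
  case/orP=> /andP[k_root /eqP fk]; [exists i|exists j]; rewrite ?inE // hE fk.
    by rewrite ltnNge ltnW.
  by rewrite ji.
rewrite big_imset; first by apply: eq_bigl => r; rewrite !inE.
move=> r q; rewrite !inE => r_root q_root.
rewrite !hE; case: ifP => _; case: ifP => _ [] //.
  by move=> fr_q r_fq; have := parent_fun_neq2 fP r_root; rewrite fr_q -r_fq eqxx.
by move=> r_fq fr_q; have := parent_fun_neq2 fP r_root; rewrite fr_q -r_fq eqxx.
Qed.

Definition edge_weight (G : {set {set 'I_n}}) i j : A :=
  (x (Order.min i j) * y (Order.max i j)) *+ adj G i j.

(** The left-hand side does not mention the root, so the determinant may be
    computed at whichever root makes it easiest. *)
Lemma tree_enumerator_det (G : {set {set 'I_n}}) (root : 'I_n) :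
  simple_graph G ->
  \sum_(T | spanning_tree G T)
    \prod_i (x i ^+ indeg T i * y i ^+ outdeg T i) =
  \det (rooted_laplacian root (edge_weight G)).
Proof.
move=> simpleG; rewrite matrix_tree (sum_spanning_trees root) //.
rewrite [RHS](bigID (fun f : {ffun _} =>
  [forall (r | r != root), adj G r (f r)])) /=.
rewrite [X in _ + X]big1 ?addr0 => [|f /andP[_]]; last first.
  rewrite negb_forall => /existsP[r]; rewrite negb_imply => /andP[r_root no_edge].
  by rewrite (bigD1 r) //= /edge_weight (negbTE no_edge) mul0r.
apply: eq_bigr => f /andP[fP /forall_inP sub].
rewrite prod_degrees_arcs prod_arcs_tree_of //=; apply: eq_bigr => r r_root.
by rewrite /edge_weight sub // mulrC.
Qed.

End TreeWeights.

(** * The Laplacian of a threshold graph *)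

(** Among the vertices other than i, the vertex j is at position j if j < i
    and at position j - 1 if i < j. *)
Lemma adj_threshold n (G : {set {set 'I_n}}) lambda i j : threshold G lambda ->
  adj G i j = (i != j) && (j < lambda i + (i < j))%N.
Proof.
case=> _ _ ->; rewrite /smallest_others -(mem_map val_inj) map_take.
have -> : map val [seq k <- enum 'I_n | k != i] =
          iota 0 i ++ iota i.+1 (n - i.+1).
  rewrite -(filter_map val (fun k => k != i :> nat)) val_enum_ord.
  rewrite -[in iota 0 n](subnKC (ltn_ord i)) -addn1 -addnA iotaD filter_cat.
  rewrite add0n addn1 /= eqxx; rewrite add0n.
  congr (_ ++ _); apply/all_filterP/allP => k;
    rewrite mem_iota; lia.
rewrite -[i == j](inj_eq val_inj) take_cat size_iota; case: ifP => lt_lam.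
  by rewrite take_iota mem_iota /=; lia.
by rewrite mem_cat take_iota !mem_iota /=; have := ltn_ord j; lia.
Qed.

Lemma ltn_card_initial n (P : pred 'I_n) (i : 'I_n) :
  (forall j k : 'I_n, (j <= k)%N -> P k -> P j) -> (i < #|[set j | P j]|)%N = P i.
Proof.
move=> down; have card_lt m : (m <= n)%N -> #|[set j : 'I_n | j < m]%N| = m.
  move=> le_m; rewrite -sum1dep_card -(big_ord_widen n (fun=> 1%N)) //.
  by rewrite sum1_card card_ord.
have [Pi|notPi] := boolP (P i).
  rewrite -(card_lt i.+1) //; apply/subset_leq_card/subsetP => j.
  by rewrite !inE ltnS => /down; apply.
apply/negbTE; rewrite -leqNgt -[leqRHS]card_lt ?(ltnW (ltn_ord i)) //.
apply/subset_leq_card/subsetP => j; rewrite !inE ltnNge => Pj.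
by apply: contra notPi => /down; apply.
Qed.

Section ThresholdDeterminant.
Variables (A : comNzRingType) (n : nat) (x y : 'I_n.+1 -> A).
Variables (G : {set {set 'I_n.+1}}) (lambda : 'I_n.+1 -> nat) (s : 'I_n.+1).
Hypothesis thrG : threshold G lambda.
(* s is the number of vertices of the clique, and also the first vertex of the
   independent set *)
Hypothesis lambda_s : lambda s = s.
Hypothesis clique_lt : forall r : 'I_n.+1, (r < s)%N -> (r < lambda r)%N.
Hypothesis lambda_gt0 : forall r, (0 < lambda r)%N.

Let w := edge_weight x y G.
Let L := rooted_laplacian s w.

Definition nbr_sum (r : 'I_n.+1) := \sum_(i < n.+1 | (i < lambda r)%N) x i.

(** For decreasing lambda, r < lambda i means that i is less than the part
    of the conjugate partition at the label of r: this is the factor at r in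
    the product formula. *)
Definition factor (r : 'I_n.+1) :=
  \sum_(i < n.+1 | (r < lambda i)%N) x (Order.min i r) * y (Order.max i r).

Lemma lambda_le_s (r : 'I_n.+1) : (s <= r)%N -> (lambda r <= s)%N.
Proof. by case: thrG => _ dec _ /dec; rewrite lambda_s. Qed.

Lemma adj_indep (r j : 'I_n.+1) : (s <= r)%N -> adj G r j = (j < lambda r)%N.
Proof.
move=> s_r; have := lambda_le_s s_r.
by rewrite (adj_threshold _ _ thrG) -[r == j](inj_eq val_inj) /=; lia.
Qed.

Lemma weight_indep (r j : 'I_n.+1) : (s <= r)%N ->
  w r j = (x j * y r) *+ (j < lambda r)%N.
Proof.
move=> s_r; rewrite /w /edge_weight adj_indep //.
case: ltnP => // j_lt; have := lambda_le_s s_r => lam_le.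
have le_jr : (j <= r)%O by rewrite leEord; lia.
by rewrite min_r // max_l.
Qed.

Lemma weight_sym i j : w i j = w j i.
Proof. by rewrite /w /edge_weight adj_sym minC maxC. Qed.

Lemma weight_row_s (j : 'I_n.+1) : w s j = y s * (if (j < s)%N then x j else 0).
Proof.
rewrite weight_indep // lambda_s mulrC.
by case: ltnP => _; rewrite ?mulr0 // mulr1n mulrC.
Qed.

Lemma sum_weight_indep (r : 'I_n.+1) : (s <= r)%N ->
  \sum_j w r j = y r * nbr_sum r.
Proof.
move=> s_r; rewrite /nbr_sum big_distrr [RHS]big_mkcond.
by apply: eq_bigr => j _; rewrite weight_indep // mulrC; case: ltnP.
Qed.

Lemma weight_clique_lt (r j : 'I_n.+1) : (r < s)%N -> (j < r)%N ->
  w r j = x j * y r.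
Proof.
move=> r_s j_r; have lam_j : (r < lambda j)%N.
  case: thrG => _ dec _; apply: leq_trans (dec j r (ltnW j_r)).
  exact: clique_lt.
rewrite weight_sym /w /edge_weight (adj_threshold _ _ thrG).
rewrite -[j == r](inj_eq val_inj) /=.
rewrite (ltn_eqF j_r) j_r ltn_addr // mulr1n.
by rewrite min_l ?max_r // leEord ltnW.
Qed.

Lemma weight_diag r : w r r = 0.
Proof. by rewrite /w /edge_weight /adj eqxx. Qed.

Lemma factor_clique (r : 'I_n.+1) : (r < s)%N ->
  factor r = \sum_j w r j + x r * y r.
Proof.
move=> r_s; have w_rr := weight_diag r.
rewrite /factor big_mkcond /= (bigD1 r) //= clique_lt // addrC.
rewrite minxx maxxx [in RHS](bigD1 r) //= w_rr add0r.
congr (_ + _); apply: eq_bigr => i i_r; rewrite /w /edge_weight (adj_sym _ r).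
rewrite (adj_threshold _ _ thrG) i_r minC maxC /=.
have [i_lt_r|r_le_i] := ltnP i r; last by rewrite addn0; case: ifP.
have lam_i : (r < lambda i)%N.
  case: thrG => _ dec _; apply: leq_trans (dec i r (ltnW i_lt_r)).
  exact: clique_lt.
by rewrite lam_i ltn_addr.
Qed.

(** The root is s. The row operations are recorded as E L = F M, where E
    adds to row 0 what turns it into y_s v, F scales row 0 back by y_s and
    subtracts y_r v from each other row r <> s, and M is triangular once
    each vertex r >= s is placed between the clique vertices lambda r - 1
    and lambda r. *)
Lemma det_threshold_laplacian :
  \det L = y s * (x ord0 * \prod_(r < n.+1 | (0 < r < s)%N) factor r
                  * \prod_(r < n.+1 | (s < r)%N) (y r * nbr_sum r)).
Proof.
have s_gt0 : (0 < s)%N by rewrite -lambda_s.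
pose v (j : 'I_n.+1) := if (j < s)%N then x j else 0.
have s_neq0 : s != ord0 by rewrite -(inj_eq val_inj) -lt0n.
pose M : 'M[A]_n.+1 := \matrix_(r, j)
  (if r == ord0 then v j else if r == s then (j == s)%:R else L r j + y r * v j).
pose E : 'M[A]_n.+1 := \matrix_(r, j)
  (if r == ord0 then (if j == s then y s * nbr_sum s else 1) else (r == j)%:R).
pose F : 'M[A]_n.+1 := \matrix_(r, j)
  (if j == ord0 then (if r == ord0 then y s else if r == s then 0 else - y r)
   else (r == j)%:R).
have EL_FM : E *m L = F *m M.
  apply/matrixP => r j; rewrite !mxE.
  have [->|r_neq0] := eqVneq r ord0.
    under eq_bigr => k _ do rewrite mxE eqxx.
    rewrite [RHS](bigD1 ord0) //=.
    rewrite [X in _ = _ + X]big1 ?addr0 => [|k k_neq0]; last first.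
      by rewrite mxE (negbTE k_neq0) eq_sym (negbTE k_neq0) mul0r.
    rewrite [in RHS]mxE [M _ _]mxE eqxx /= -/(v j) -weight_row_s.
    (* row 0: the sum of the rows other than s is the opposite of the row that
       the full Laplacian has at s, up to the diagonal entry of that row, which
       the entry of E in column s compensates *)
    rewrite (bigD1 s) //= eqxx [L s j]mxE eqxx.
    under eq_bigr => k k_s do rewrite (negbTE k_s) mul1r mxE (negbTE k_s).
    rewrite sumrB -sum_weight_indep //.
    have -> : \sum_(k < n.+1 | k != s) w k j = \sum_k w j k - w s j.
      rewrite [X in X - _](bigD1 s) //= [w j s]weight_sym.
      rewrite [_ + (\sum_(_ | _) _)]addrC addrK.
      by apply: eq_bigr => k _; rewrite weight_sym.
    have [->|j_s] := eqVneq j s.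
      rewrite mulr1 [X in _ + (X - _)]big1 => [|k /negbTE->].
        by rewrite sub0r opprB addrC subrK.
      by rewrite mul0r.
    rewrite mulr0 add0r (bigD1 j) //= eqxx mul1r.
    rewrite [X in _ + X - _]big1 => [|k /andP[_ k_j]].
      by rewrite addr0 opprB addrC subrK.
    by rewrite (negbTE k_j) mul0r.
  rewrite (bigD1 r) //= [E r r]mxE (negbTE r_neq0) eqxx mul1r.
  rewrite big1 ?addr0 => [|k k_r]; last first.
    by rewrite [E r k]mxE (negbTE r_neq0) eq_sym (negbTE k_r) mul0r.
  rewrite (bigD1 ord0) //= [F r ord0]mxE eqxx (negbTE r_neq0).
  rewrite (bigD1 r) //= big1 ?addr0 => [|k /andP[k_neq0 k_r]]; last first.
    by rewrite [F r k]mxE (negbTE k_neq0) eq_sym (negbTE k_r) mul0r.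
  rewrite [F r r]mxE (negbTE r_neq0) eqxx mul1r ![M _ _]mxE eqxx (negbTE r_neq0).
  have [->|_] := eqVneq r s; first by rewrite mul0r add0r [L s j]mxE eqxx.
  by rewrite mulNr addrCA addNr addr0.
have detE : \det E = 1.
  rewrite (det_ranked (rank := fun r => (r != ord0) : nat)) => [|r j r_j].
    rewrite big1 // => r _; rewrite mxE eqxx.
    by case: eqVneq => [->|//]; rewrite eq_sym (negbTE s_neq0).
  rewrite mxE (negbTE r_j); case: (eqVneq r ord0) => [r0|_] /=;
    last by rewrite eqxx.
  by move=> _; rewrite -r0 eq_sym r_j.
have detF : \det F = y s.
  rewrite (det_ranked (rank := fun r => (r == ord0) : nat)) => [|r j r_j].
    rewrite (bigD1 ord0) //= mxE eqxx big1 ?mulr1 // => r /negbTE r_neq0.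
    by rewrite mxE r_neq0 eqxx.
  rewrite mxE (negbTE r_j); case: (eqVneq j ord0) => [j0|_] /=;
    last by rewrite eqxx.
  by move=> _; rewrite -j0 (negbTE r_j).
(* twice the position for a clique vertex, which leaves odd ranks for the
   independent vertices *)
have detM : \det M = \prod_r M r r.
  apply: (det_ranked (rank := fun r : 'I_n.+1 =>
    if (r < s)%N then r.*2 else (lambda r).*2.-1)) => r j r_j.
  rewrite mxE; have [r0|r_neq0] := eqVneq r ord0.
    rewrite {r}r0 in r_j *; rewrite s_gt0 /v.
    case: ltnP => [_ _|_]; last by rewrite eqxx.
    by rewrite ltn_double lt0n (inj_eq val_inj j ord0) eq_sym.
  have [r_s|r_neq_s] := eqVneq r s.
    by rewrite -r_s [j == r]eq_sym (negbTE r_j) /= eqxx.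
  rewrite [L r j]mxE (negbTE r_neq_s) (negbTE r_j) mul0r sub0r /v.
  have rj : val r != val j by rewrite (inj_eq val_inj).
  (* the remaining rows: L r j + y_r v_j for r in the clique, then for r > s *)
  have [r_s|s_r] := ltnP r s.
    have [j_r|r_le_j] := ltnP j r.
      by rewrite weight_clique_lt // (ltn_trans j_r) // mulrC addNr eqxx.
    have [j_s _|s_j] := ltnP j s; first by rewrite ltn_double ltn_neqAle rj.
    rewrite weight_sym weight_indep // mulr0 addr0.
    have [r_lam _|_] := ltnP r (lambda j); last by rewrite oppr0 eqxx.
    by lia.
  rewrite weight_indep //; have := lambda_le_s s_r => lam_r.
  have [j_s|s_j] := ltnP j s; last first.
    by rewrite ltnNge (leq_trans lam_r) // oppr0 mulr0 addr0 eqxx.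
  have [_|lam_j _] := ltnP j (lambda r); first by rewrite mulrC addNr eqxx.
  by have := lambda_gt0 r; lia.
have := congr1 determinant EL_FM; rewrite !det_mulmx detE detF mul1r => ->.
congr (_ * _); rewrite {}detM (bigD1 ord0) //= -mulrA; congr (_ * _).
  by rewrite mxE eqxx /v s_gt0.
rewrite (bigID (fun r : 'I_n.+1 => (r < s)%N)) /=; congr (_ * _).
  apply: eq_big => [r|r /andP[r_neq0 r_s]].
    by rewrite lt0n (inj_eq val_inj r ord0).
  have r_neq_s : r != s by rewrite -(inj_eq val_inj) ltn_eqF.
  rewrite mxE (negbTE r_neq0) (negbTE r_neq_s) mxE (negbTE r_neq_s) eqxx mul1r.
  by rewrite weight_diag subr0 /v r_s factor_clique // [y r * _]mulrC.
rewrite (bigD1 s) /=; last by rewrite s_neq0 ltnn.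
rewrite [M s s]mxE (negbTE s_neq0) eqxx mul1r; apply: eq_big => [r|r].
  rewrite -leqNgt -[r == ord0](inj_eq val_inj) -[r == s](inj_eq val_inj) /=.
  by lia.
rewrite -leqNgt => /andP[/andP[r_neq0 s_r] r_neq_s].
rewrite mxE (negbTE r_neq0) (negbTE r_neq_s) mxE (negbTE r_neq_s) eqxx mul1r.
rewrite weight_diag subr0 /v ltnNge s_r mulr0 addr0.
exact: sum_weight_indep.
Qed.

End ThresholdDeterminant.
(** * The product formula *)

Section ConnectedThreshold.
Variables (n : nat) (G : {set {set 'I_n.+2}}) (lambda : 'I_n.+2 -> nat).
Hypothesis connG : connected G.
Hypothesis thrG : threshold G lambda.

Lemma deg_gt0 i : (0 < lambda i)%N.
Proof.
have [j ij] : {j | j != i} by exists (lift i ord0); rewrite eq_sym neq_lift.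
have /connectP[[|k p] /= path_p last_p] := forallP (forallP connG i) j.
  by rewrite last_p eqxx in ij.
case/andP: path_p => ik _; case: thrG => -> _ _.
by rewrite /deg card_gt0; apply/set0Pn; exists k; rewrite inE.
Qed.

(** s is the least vertex with lambda s <= s. Its predecessor p has s <=
    lambda p, hence is adjacent to s; by symmetry p < lambda s, so that s <=
    lambda s. *)
Lemma clique_size : exists s : 'I_n.+2,
  lambda s = s /\ forall r : 'I_n.+2, (r < s)%N -> (r < lambda r)%N.
Proof.
have max_le : (lambda ord_max <= @ord_max n.+1)%N.
  case: thrG => -> _ _; rewrite /deg -ltnS -[ltnRHS]card_ord -cardsT.
  apply: proper_card; apply/properP; split; first exact: subsetT.
  by exists ord_max; rewrite !inE // /adj eqxx.
pose P (r : 'I_n.+2) := (lambda r <= r)%N.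
case: (@arg_minnP _ _ P val max_le) => s Ps s_min.
have before (r : 'I_n.+2) : (r < s)%N -> (r < lambda r)%N.
  by move=> r_s; rewrite ltnNge; apply: contraL r_s => /s_min; rewrite -leqNgt.
exists s; split=> //; apply/eqP; rewrite eqn_leq (Ps : (lambda s <= s)%N) leqNgt.
apply/negP => lam_s.
have s_gt0 : (0 < s)%N := leq_trans (deg_gt0 s) Ps.
have p_lt : (s.-1 < n.+2)%N by apply: leq_ltn_trans (leq_pred s) (ltn_ord s).
pose p := Ordinal p_lt; have p_s : (p < s)%N by rewrite /= prednK.
have := adj_sym G p s; rewrite !(adj_threshold _ _ thrG) -!(inj_eq val_inj) /=.
have := before p p_s; rewrite /=.
by move: lam_s s_gt0 p_s; rewrite /=; move: (lambda p) => l; lia.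
Qed.

Lemma ltn_conj_part r (i : 'I_n.+2) :
  (i < conj_part lambda r.+1)%N = (r < lambda i)%N.
Proof.
rewrite /conj_part; apply: (ltn_card_initial (P := fun i => (r < lambda i)%N)).
by move=> j k jk lam_k; case: thrG => _ dec _; apply: leq_trans (dec j k jk).
Qed.

End ConnectedThreshold.

(** Both sides contain x_0 and the factors at the vertices 0 < r < s. For s
    <= r, the factor at r is y_r times the sum of the x_i over the
    neighbours i of r + 1, so the tails of the two products agree after the
    x-sums are shifted by one place, the y_s in front of the determinant and
    the last y filling the two ends. *)
Theorem threshold_tree_enumerator (A : comNzRingType) n
    (G : {set {set 'I_n.+2}}) lambda (x y : 'I_n.+2 -> A) :
  simple_graph G -> connected G -> threshold G lambda ->
  \sum_(T | spanning_tree G T)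
    \prod_i (x i ^+ indeg T i * y i ^+ outdeg T i) =
  x ord0 * y ord_max *
    \prod_(r < n.+2 | (0 < r < n.+1)%N) factor x y lambda r.
Proof.
move=> simpleG connG thrG.
have [s [lambda_s clique_lt]] := clique_size connG thrG.
have lambda_gt0 := deg_gt0 connG thrG.
rewrite (tree_enumerator_det _ _ s) //.
rewrite (det_threshold_laplacian _ _ thrG lambda_s) //.
have s_gt0 : (0 < s)%N by rewrite -lambda_s.
have factorE (r : 'I_n.+1) : (s <= r)%N ->
    factor x y lambda (widen_ord (leqnSn n.+1) r) =
    y (widen_ord (leqnSn n.+1) r) * nbr_sum x lambda (lift ord0 r).
  move=> s_r; rewrite /nbr_sum big_distrr /=.
  have lam_small (i : 'I_n.+2) : (s <= i)%N -> (lambda i <= s)%N.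
    exact: lambda_le_s thrG lambda_s i.
  apply: eq_big => [i|i r_lam].
    have := adj_sym G i (lift ord0 r).
    rewrite [in X in _ = X -> _](adj_indep thrG lambda_s) /=; last first.
      exact: leqW.
    rewrite (adj_threshold _ _ thrG) -(inj_eq val_inj) /= /bump add1n.
    have := lam_small i; have := lam_small (lift ord0 r).
    by rewrite /= /bump add1n; lia.
  have i_s : (i < s)%N.
    by rewrite ltnNge; apply/negP => /lam_small; move: r_lam s_r; rewrite /=; lia.
  have i_r : (i <= widen_ord (leqnSn n.+1) r)%O.
    by rewrite leEord /= ltnW // (leq_trans i_s).
  by rewrite min_l // max_r // mulrC.
have tailE : y s * \prod_(r < n.+2 | (s < r)%N) (y r * nbr_sum x lambda r) =
    y ord_max * \prod_(r < n.+2 | (s <= r < n.+1)%N) factor x y lambda r.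
  rewrite big_split mulrA /=; have -> : y s * \prod_(r < n.+2 | (s < r)%N) y r =
      \prod_(r < n.+2 | (s <= r)%N) y r.
    rewrite [RHS](bigD1 s) //=; congr (_ * _); apply: eq_bigl => r.
    by rewrite ltn_neqAle -[r == s](inj_eq val_inj) eq_sym andbC.
  rewrite big_mkcond big_ord_recr /= -big_mkcond -ltnS ltn_ord.
  rewrite [\prod_(r < n.+2 | (s < r)%N) _]big_mkcond big_ord_recl /= mul1r.
  rewrite -big_mkcond [in RHS]big_mkcond big_ord_recr /= ltnn andbF mulr1.
  rewrite -big_mkcond /= mulrAC mulrC -big_split /=; congr (_ * _).
  apply: eq_big => [r|r s_r]; last by rewrite factorE.
  by rewrite ltn_ord andbT.
rewrite [in RHS](bigID (fun r : 'I_n.+2 => (r < s)%N)) /=.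
rewrite [X in _ = _ * (X * _)](eq_bigl (fun r : 'I_n.+2 => (0 < r < s)%N));
  last by move=> r; have := ltn_ord s; lia.
rewrite [X in _ = _ * (_ * X)](eq_bigl (fun r : 'I_n.+2 => (s <= r < n.+1)%N));
  last by move=> r; lia.
by rewrite mulrCA tailE mulrACA.
Qed.

Lemma deg_orient n (T : {set {set 'I_n}}) i :
  deg T i = (indeg T i + outdeg T i)%N.
Proof.
rewrite /deg -(cardsID [set j : 'I_n | (i < j)%N]) /indeg /outdeg.
congr (_ + _)%N; apply: eq_card => j; rewrite !inE /Defs.arc.
  by rewrite adj_sym andbC.
rewrite -leqNgt leq_eqVlt (inj_eq val_inj); case: eqVneq => [->|//].
by rewrite ltnn /adj eqxx.
Qed.

Lemma factor_self (A : comNzRingType) n (x : 'I_n.+1 -> A) lambda r :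
  factor x x lambda r = x r * \sum_(i < n.+1 | (r < lambda i)%N) x i.
Proof.
rewrite /factor big_distrr; apply: eq_bigr => i _ /=.
by rewrite minElt maxElt; case: ifP; rewrite // mulrC.
Qed.

(* There are n.+2 vertices. The ordinal r stands for the label r.+1, so that
   conj_part lambda r.+1 is the part of the conjugate partition at that label. *)
Theorem theorem4 (R : comNzRingType) (n : nat)
    (G : {set {set 'I_n.+2}}) (lambda : 'I_n.+2 -> nat) :
  simple_graph G -> connected G -> threshold G lambda ->
  let x := @xvar n.+2 R in
  let y := @yvar n.+2 R in
  (\sum_(T : {set {set 'I_n.+2}} | spanning_tree G T)
      \prod_(i < n.+2) (x i ^+ indeg T i * y i ^+ outdeg T i)
   = x ord0 * y ord_max *
     \prod_(r < n.+2 | (0 < r < n.+1)%N)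
       \sum_(i < n.+2 | (i < conj_part lambda r.+1)%N)
         x (Order.min i r) * y (Order.max i r))
  /\
  (\sum_(T : {set {set 'I_n.+2}} | spanning_tree G T)
      \prod_(i < n.+2) x i ^+ deg T i
   = (\prod_(i < n.+2) x i) *
     \prod_(r < n.+2 | (0 < r < n.+1)%N)
       \sum_(i < n.+2 | (i < conj_part lambda r.+1)%N) x i).
Proof.
move=> simpleG connG thrG x y; split.
  rewrite (threshold_tree_enumerator _ _ simpleG connG thrG).
  congr (_ * _); apply: eq_bigr => r _; apply: eq_bigl => i.
  by rewrite (ltn_conj_part thrG).
have := threshold_tree_enumerator x x simpleG connG thrG.
under eq_bigr => T _ do under eq_bigr => i _ do rewrite -exprD -deg_orient.
move=> ->; have -> : \prod_(i < n.+2) x i =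
    x ord0 * x ord_max * \prod_(r < n.+2 | (0 < r < n.+1)%N) x r.
  rewrite (bigD1 ord0) //= (bigD1 ord_max) //= -mulrA; congr (_ * (_ * _)).
  apply: eq_bigl => r; rewrite -[r == ord0](inj_eq val_inj).
  by rewrite -[r == ord_max](inj_eq val_inj) /=; have := ltn_ord r; lia.
rewrite -[RHS]mulrA -big_split; congr (_ * _); apply: eq_bigr => r _.
rewrite factor_self; congr (_ * _); apply: eq_bigl => i.
by rewrite (ltn_conj_part thrG).
Qed.
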